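(* Let $f:\mathbb{R}^d\to\mathbb{R}$ be convex and $1$-smooth, let $h:\mathbb{R}^d\to\mathbb{R}\cup\{+\infty\}$ be proper, closed and convex, let $F=f+h$, and let $x_*$ be a minimizer of $F$. For $k\in\mathbb{N}$, $k\ge1$, and $n=2^k-1$, the iterates of proximal gradient descent with the silver stepsizes, $$x_t=\mathrm{prox}_{\pi^{(k)}_t h}\big(x_{t-1}-\pi_t^{(k)}\nabla f(x_{t-1})\big),\qquad 1\le t\le n,$$ started from any $x_0\in\mathbb{R}^d$, satisfy $$F(x_n)-F(x_* )\le\frac{\rho}{\sqrt2\,(4\rho^k-2)}\|x_0-x_*\|^2 .$$ Moreover $\dfrac{\rho}{\sqrt2(4\rho^k-2)}\sim\dfrac{\rho}{4\sqrt2\,n^{\log_2\rho}}$ as $k\to\infty$.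
   Context: $\rho=1+\sqrt2$. The silver stepsize schedule of length $n=2^k-1$ is $\pi^{(k)}=[\pi^{(k)}_1,\dots,\pi^{(k)}_n]$ with $\pi_i^{(k)}=1+\rho^{\nu(i)-1}$, where $\nu(i)$ is the largest integer $j$ such that $2^j$ divides $i$. $\mathrm{prox}_{\alpha h}(x)=\arg\min_z\{\alpha h(z)+\frac12\|z-x\|^2\}$. $1$-smooth means differentiable with $1$-Lipschitz gradient. $a_n\sim b_n$ means $a_n/b_n\to1$. *)

(* Defs.v *)
From HB Require Import structures.
From mathcomp Require Import all_boot all_order all_algebra.
From mathcomp Require Import all_classical all_reals all_analysis.

Set Implicit Arguments.
Unset Strict Implicit.
Unset Printing Implicit Defensive.

Import Order.TTheory GRing.Theory Num.Theory.
Import numFieldNormedType.Exports.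

Local Open Scope classical_set_scope.
Local Open Scope ring_scope.

Section defs.
Context {R : realType}.

(* The library norm on ['rV[R]_d] is the sup norm; it induces the same topology
   and differentiability as [enorm], but not the same Lipschitz constants. *)
Definition enorm (d : nat) (x : 'rV[R]_d) : R :=
  Num.sqrt (\sum_(i < d) x 0 i ^+ 2).

Definition gradient (d : nat) (f : 'rV[R]_d -> R) (x : 'rV[R]_d) : 'rV[R]_d :=
  \row_(i < d) 'D_(delta_mx 0 i) f x.

Definition smooth (d : nat) (L : R) (f : 'rV[R]_d -> R) : Prop :=
  (forall x, differentiable f x) /\
  (forall x y, enorm (gradient f x - gradient f y) <= L * enorm (x - y)).

Definition proper_fun (d : nat) (h : 'rV[R]_d -> \bar R) : Prop :=
  (forall x, h x != -oo%E) /\ (exists x, h x != +oo%E).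

Definition epigraph (d : nat) (h : 'rV[R]_d -> \bar R) : set ('rV[R]_d * R) :=
  [set p | (h p.1 <= p.2%:E)%E].

Definition closed_fun (d : nat) (h : 'rV[R]_d -> \bar R) : Prop :=
  closed (epigraph h).

(* Used only for functions that avoid -oo, so that the sum on the right is never
   of the form +oo - oo; at t = 0 and t = 1 the convention 0 * +oo = 0 makes the
   inequality trivial. *)
Definition econvex_fun (d : nat) (h : 'rV[R]_d -> \bar R) : Prop :=
  forall (x y : 'rV[R]_d) (t : R), 0 <= t <= 1 ->
    (h ((1 - t) *: x + t *: y)%R <= (1 - t)%:E * h x + t%:E * h y)%E.

Definition argmin (d : nat) (g : 'rV[R]_d -> \bar R) : set 'rV[R]_d :=
  [set z | forall y, (g z <= g y)%E].

(* The argmin is a singleton for h proper, closed and convex and a > 0; [xget]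
   extracts its element, and returns 0 if the argmin is empty. *)
Definition prox (d : nat) (a : R) (h : 'rV[R]_d -> \bar R) (x : 'rV[R]_d) :
    'rV[R]_d :=
  xget 0 (argmin (fun z => a%:E * h z + (2^-1 * enorm (z - x) ^+ 2)%:E)%E).

Fixpoint prox_grad (d : nat) (f : 'rV[R]_d -> R) (h : 'rV[R]_d -> \bar R)
    (s : nat -> R) (x0 : 'rV[R]_d) (t : nat) : 'rV[R]_d :=
  if t is u.+1 then
    let x := prox_grad f h s x0 u in
    prox (s u.+1) h (x - s u.+1 *: gradient f x)
  else x0.

Definition rho : R := 1 + Num.sqrt 2.

(* The i-th entry of the silver schedule, i >= 1; it does not depend on the
   length 2^k - 1 of the schedule. The exponent is an [int], equal to -1 for
   odd i. *)
Definition silver (i : nat) : R := 1 + rho ^ ((logn 2 i)%:Z - 1).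

Definition asymp_equiv (a b : nat -> R) : Prop :=
  (a k / b k) @[k --> \oo] --> (1 : R).

End defs.

Arguments rho : clear implicits.

(* Main.v *)
Require Import Defs.
From HB Require Import structures.
From mathcomp Require Import all_boot all_order all_algebra.
From mathcomp Require Import all_classical all_reals all_analysis.
From mathcomp Require Import ring lra zify.

Import Order.TTheory GRing.Theory Num.Theory.
Import numFieldNormedType.Exports.

Local Open Scope classical_set_scope.
Local Open Scope ring_scope.

(** Tilting by the gradient at the minimizer normalizes [x* = 0], [f* = h* = 0]
    and [g* = s* = 0], and each step reads [x_t = x_{t-1} - p_t (g_{t-1} + s_t)]
    with [g] the gradients of [f] and [s] the subgradients of [h]. By induction
    on [k], an estimate is proved that retains, besides the function values, a
    nonnegative combination of total weight [rho^k (rho^k - 1)] of the terms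
    [|g_n + s_j|^2 + 2 H_j], where [H_j >= 0] is the gap of the subgradient
    inequality of [h] at [x_j] evaluated at [x_n]. On the first half of the
    schedule only the total weight matters. The second half is used [rho^2]
    times, and the surplus is cancelled by [rho] times each of two telescoped
    estimates of [|x_j - u|^2], with [u] the point before the middle step and
    [u] the last point; this uses [rho^2 - 2 rho = 1]. Comparing the final
    estimate with the telescoped [|x_j|^2] gives the rate. *)

(** * The Euclidean inner product *)

Section EuclideanProduct.
Context {R : realType} {d : nat}.
Implicit Types (x y z : 'rV[R]_d) (a : R).

Definition dot x y : R := \sum_(i < d) x 0 i * y 0 i.

Lemma dotC x y : dot x y = dot y x.
Proof. by apply: eq_bigr => i _; rewrite mulrC. Qed.

Lemma dotDl x y z : dot (x + y) z = dot x z + dot y z.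
Proof. by rewrite /dot -big_split; apply: eq_bigr => i _; rewrite mxE mulrDl. Qed.

Lemma dotZl a x y : dot (a *: x) y = a * dot x y.
Proof. by rewrite /dot big_distrr; apply: eq_bigr => i _; rewrite /= mxE mulrA. Qed.

Lemma dotDr x y z : dot x (y + z) = dot x y + dot x z.
Proof. by rewrite dotC dotDl !(dotC x). Qed.

Lemma dotZr a x y : dot x (a *: y) = a * dot x y.
Proof. by rewrite dotC dotZl (dotC x). Qed.

Lemma dotNl x y : dot (- x) y = - dot x y.
Proof. by rewrite -scaleN1r dotZl mulN1r. Qed.

Lemma dotNr x y : dot x (- y) = - dot x y.
Proof. by rewrite dotC dotNl dotC. Qed.

Lemma dot0l y : dot 0 y = 0.
Proof. by rewrite -(scale0r y) dotZl mul0r. Qed.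

Lemma dot0r x : dot x 0 = 0.
Proof. by rewrite dotC dot0l. Qed.

Definition dotE := (dotDl, dotDr, dotNl, dotNr, dotZl, dotZr, dot0l, dot0r).

Lemma dot_ge0 x : 0 <= dot x x.
Proof. by apply: sumr_ge0 => i _; rewrite -expr2 sqr_ge0. Qed.

Lemma dot_sumr (I : Type) (r : seq I) x (F : I -> 'rV[R]_d) :
  dot x (\sum_(i <- r) F i) = \sum_(i <- r) dot x (F i).
Proof.
elim: r => [|i r IH]; first by rewrite !big_nil dot0r.
by rewrite !big_cons dotDr IH.
Qed.

Lemma enorm_sqr x : enorm x ^+ 2 = dot x x.
Proof.
rewrite sqr_sqrtr; first by apply: eq_bigr => i _; rewrite expr2.
by apply: sumr_ge0 => i _; rewrite sqr_ge0.
Qed.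

Lemma enorm_ge0 x : 0 <= enorm x.
Proof. exact: sqrtr_ge0. Qed.

End EuclideanProduct.

(** * Self-similarity and sums of the silver schedule *)

Section SilverSchedule.
Context {R : realType}.
Let r := rho R.

Lemma rho_sqr : r ^+ 2 = 2 * r + 1.
Proof.
have s2 : Num.sqrt (2 : R) ^+ 2 = 2 by rewrite sqr_sqrtr.
rewrite /r /rho; ring: s2.
Qed.

Lemma rho_gt1 : 1 < r.
Proof. by rewrite /r /rho ltrDl sqrtr_gt0. Qed.

Lemma rho_gt0 : 0 < r.
Proof. exact: lt_trans rho_gt1. Qed.

Lemma silver_gt1 i : 1 < silver i :> R.
Proof. by rewrite /silver ltrDl exprz_gt0 // rho_gt0. Qed.

Lemma silver_gt0 i : 0 < silver i :> R.
Proof. exact: lt_trans (silver_gt1 i). Qed.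

Lemma silver_exp2 k : r ^+ k = r * (silver (2 ^ k) - 1).
Proof.
rewrite /silver pfactorK // addrAC subrr add0r -/r.
rewrite exprzDr ?unitfE ?gt_eqF ?rho_gt0 // mulrCA.
by rewrite -exprnP exprN1 mulfV ?mulr1 // gt_eqF ?rho_gt0.
Qed.

Lemma silver1 : silver 1 = r - 1.
Proof.
have := silver_exp2 0; rewrite expr0 expn0 => h.
have r0 : r != 0 by rewrite gt_eqF ?rho_gt0.
apply: (mulfI r0); rewrite mulrBr mulr1 -expr2 rho_sqr.
by rewrite -[X in X = _](subrK r) -{2}(mulr1 r) -mulrBr -h; ring.
Qed.

(** Numbers below [2 ^ k] have 2-adic valuation below [k], so adding [2 ^ k] does not change it. *)
Lemma silver_shift k i : (i < 2 ^ k - 1)%N ->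
  silver (2 ^ k + i.+1) = silver i.+1 :> R.
Proof.
move=> ik; rewrite /silver; congr (1 + _ ^ (_%:Z - 1)).
have ik' : (i.+1 < 2 ^ k)%N by rewrite -ltn_predRL -subn1.
have lk : (logn 2 i.+1 < k)%N.
  have := pfactor_dvdnn 2 i.+1 => /dvdn_leq -/(_ isT) h.
  by rewrite -(ltn_exp2l _ _ (isT : (1 < 2)%N)); apply: leq_ltn_trans ik'.
apply/eqP; rewrite eqn_leq; apply/andP; split.
- rewrite leqNgt; apply/negP => h.
  have : (2 ^ (logn 2 i.+1).+1 %| 2 ^ k + i.+1)%N.
    by rewrite pfactor_dvdn // addnS.
  by rewrite dvdn_addr ?dvdn_exp2l // pfactor_dvdn // ltnn.
- rewrite -pfactor_dvdn ?addnS // -addnS dvdn_addr ?pfactor_dvdnn //.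
  by rewrite dvdn_exp2l // ltnW.
Qed.

Lemma expn2_pred k : ((2 ^ k - 1).+1 = 2 ^ k)%N.
Proof. by rewrite subn1 prednK // expn_gt0. Qed.

(* A schedule of length [2^(k+1) - 1] is two copies of the schedule of length
   [2^k - 1] around the step [silver (2^k)]. *)
Lemma sum_silver_split (V : nmodType) k (F : nat -> V) :
  \sum_(j < 2 ^ k.+1 - 1) F j =
  \sum_(j < 2 ^ k - 1) F j + F (2 ^ k - 1)%N
  + \sum_(j < 2 ^ k - 1) F (2 ^ k + j)%N.
Proof.
have e : (2 ^ k.+1 - 1 = (2 ^ k - 1).+1 + (2 ^ k - 1))%N.
  by rewrite expnS; have := expn_gt0 2 k; case: (2 ^ k)%N => // a _; lia.
rewrite e big_split_ord big_ord_recr /=; congr (_ + _).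
by apply: eq_bigr => j _; congr F; rewrite expn2_pred.
Qed.

Lemma sum_silver k : \sum_(j < 2 ^ k - 1) silver j.+1 = r ^+ k - 1.
Proof.
elim: k => [|k IH]; first by rewrite expn0 big_ord0 subrr.
rewrite (sum_silver_split _ k (fun j => silver j.+1)) IH expn2_pred.
rewrite (eq_bigr (fun j : 'I_(2 ^ k - 1) => silver j.+1 : R)); last first.
  by move=> j _; rewrite -addnS silver_shift.
rewrite IH; have h := silver_exp2 k; have s := rho_sqr.
(* By [rho_sqr], [r - 2] is the inverse of [r]. *)
have -> : silver (2 ^ k) = (r - 2) * r ^+ k + 1.
  apply: (mulfI (lt0r_neq0 rho_gt0)); rewrite -/r.
  by move: (r ^+ k) (silver _) h => q b h; ring: h s.
by rewrite exprS; ring.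
Qed.

End SilverSchedule.

(** * Estimates for an abstract run with silver steps *)

Section AbstractRun.
Context {R : realType} {d : nat}.
Let r := rho R.
Let V := 'rV[R]_d.
Let p (j : nat) : R := silver j.+1.

(* Interpolation inequality of a convex 1-smooth function at two points with
   values [fu], [fv] and gradients [gu], [gv]. *)
Definition smooth_ineq (u v gu gv : V) (fu fv : R) : Prop :=
  fv + dot gv (u - v) + 2^-1 * dot (gu - gv) (gu - gv) <= fu.

(* [s j] is a subgradient of [h] at [x j]; only indices [j >= 1] are
   constrained, as the starting point need not lie in the domain of [h]. *)
Definition silver_run (n : nat) (x g s : nat -> V) (f e : nat -> R) : Prop :=
  [/\ forall j, (j < n)%N -> x j.+1 = x j - p j *: (g j + s j.+1),
      forall i j, (i <= n)%N -> (j <= n)%N ->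
        smooth_ineq (x i) (x j) (g i) (g j) (f i) (f j) &
      forall i j, (0 < i <= n)%N -> (0 < j <= n)%N ->
        e j + dot (s j) (x i - x j) <= e i].

(** Twice this term bounds from below the decrease of [|x j|^2] in one step when the minimizer is
    the origin. The products of [g j] with [s j.+1] cancel because [s j.+1] belongs to the new
    point. *)
Definition run_term (g s : nat -> V) (f e : nat -> R) (j : nat) : R :=
  p j * (f j + e j.+1) + 2^-1 * (p j * (1 - p j) * dot (g j) (g j)
                                 + p j ^+ 2 * dot (s j.+1) (s j.+1)).

(* The telescoping of [|x j - u|^2] against a reference point [u], with shifts
   [sig], [psi] left free: the gradient shift [gam] and the subgradient shift
   [sig] are what makes two such estimates combine exactly in the recursion. *)
Lemma run_reference n (x g s : nat -> V) (f e : nat -> R) (u gam sig : V)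
    (phi psi : R) :
  (forall j, (j < n)%N -> x j.+1 = x j - p j *: (g j + s j.+1)) ->
  (forall j, (j < n)%N -> smooth_ineq u (x j) gam (g j) phi (f j)) ->
  2 * \sum_(j < n) run_term g s f e j
  + 2 * \sum_(j < n) p j *
      (psi - e j.+1 - dot (s j.+1) (u - gam - sig - x j.+1))
  <= (\sum_(j < n) p j) * (2 * (phi + psi) - dot gam gam)
     + dot (x 0%N - u) (x 0%N - u) - dot (x n - u) (x n - u)
     + 2 * dot gam (x 0%N - x n) + 2 * dot sig (\sum_(j < n) p j *: s j.+1).
Proof.
elim: n => [|n IH] hx hQ.
  by rewrite !big_ord0 !subrr !dotE; lra.
have {}IH := IH (fun j jn => hx j (ltnW jn)) (fun j jn => hQ j (ltnW jn)).
have hxn := hx n (ltnSn n); have hQn := hQ n (ltnSn n).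
rewrite !big_ord_recr /= hxn.
move: (\sum_(j < n) run_term g s f e j) (\sum_(j < n) p j)
  (\sum_(j < n) p j *: s j.+1) (\sum_(j < n) _) IH => C A P T.
rewrite /run_term.
move: (x 0%N) (x n) (g n) (s n.+1) (f n) (e n.+1) hQn => x0 xn gn sn fn en.
rewrite /smooth_ineq => hQn IH.
have {hQn} := ler_wpM2l (ltW (silver_gt0 n.+1)) hQn.
rewrite -/(p n); move: (p n) IH => q.
rewrite !dotE (dotC xn u) (dotC gn xn) (dotC gn u) (dotC sn xn) (dotC sn u).
rewrite (dotC gam sn) (dotC gn sn) (dotC gam gn) (dotC x0 u) (dotC sig sn).
rewrite ?(dotC gam xn) ?(dotC gam x0) ?(dotC sig xn) ?(dotC u gn) ?(dotC xn gn).
nra.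
Qed.

(* The linear combination behind the doubling of the schedule: [a1], [a2] are
   the two halves, [c1], [c2] the two reference estimates on the second half. *)
Lemma doubling_combination (b del fm fn em1 en S1 S TH TP C1 C2 Z : R)
    (xm gm sg gn xn P : V) (q := r * (b - 1)) (em := em1 + b * del)
    (x1 := xm - b *: (gm + sg)) :
  1 <= b ->
  q * (q - 1) * (dot gm gm - dot sg sg + 2 * del) + S1
    <= 2 * C1 - 2 * (q - 1) * (fm + em) + Z - 2 * em ->
  TH + S <= 2 * C2 - 2 * (q - 1) * (fn + en) + 2 * (em1 - en) ->
  2 * C2 <= (q - 1) * (2 * (fm + (em - del)) - dot gm gm)
    + dot (x1 - xm) (x1 - xm) - dot (xn - xm) (xn - xm)
    + 2 * dot gm (x1 - xn) + 2 * dot sg P ->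
  2 * C2 + 2 * TP <= (q - 1) * (2 * (fn + en) - dot gn gn)
    + dot (x1 - xn) (x1 - xn) + 2 * dot gn (x1 - xn) - 2 * dot gn P ->
  0 <= S - 2 * dot sg P + (q - 1) * dot sg sg ->
  smooth_ineq xm xn gm gn fm fn ->
  smooth_ineq xn xm gn gm fn fm ->
  dot sg (gm + sg) <= del ->
  r * b * (dot (gn + sg) (gn + sg) + 2 * (en - em1 - dot sg (xn - x1)))
  + r ^+ 2 * TH + r * ((q - 1) * dot gn gn + 2 * dot gn P + S) + 2 * r * TP
  + (S1 + b * dot sg sg + S)
  <= 2 * (C1 + (b * (fm + em1) + 2^-1 * (b * (1 - b) * dot gm gm
                                         + b ^+ 2 * dot sg sg)) + C2)
     - 2 * (r * q - 1) * (fn + en) + Z - 2 * en.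
Proof.
move=> b1 a1 a2 c1 c2 sq Qmn Qnm hd.
have r0 : 0 <= r := ltW (rho_gt0 (R := R)).
have q0 : 0 <= q by rewrite mulr_ge0 // subr_ge0.
have rs : r ^+ 2 = 2 * r + 1 := rho_sqr.
rewrite -subr_ge0 in a1; rewrite -subr_ge0 in a2.
rewrite -subr_ge0 in c1; rewrite -subr_ge0 in c2.
rewrite /smooth_ineq -subr_ge0 in Qmn; rewrite /smooth_ineq -subr_ge0 in Qnm.
rewrite -subr_ge0 in hd.
(* With [a1] taken once and the others scaled as follows, the slacks add up exactly to the slack of
   the goal, modulo [rs]. *)
have {}a2 := mulr_ge0 (exprn_ge0 2 r0) a2.
have {}c1 := mulr_ge0 r0 c1; have {}c2 := mulr_ge0 r0 c2.
have {}sq := mulr_ge0 r0 sq.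
have {}Qmn := mulr_ge0 (mulr_ge0 (ler0n R 2) r0) Qmn.
have {}Qnm := mulr_ge0 (mulr_ge0 (ler0n R 2) q0) Qnm.
have {}hd := mulr_ge0 (mulr_ge0 (mulr_ge0 (ler0n R 2) q0) (le_trans ler01 b1)) hd.
rewrite -subr_ge0.
have := addr_ge0 (addr_ge0 (addr_ge0 (addr_ge0 a1 a2) (addr_ge0 c1 c2)) sq)
  (addr_ge0 (addr_ge0 Qmn Qnm) hd).
move/le_trans; apply; rewrite le_eqVlt; apply/orP; left; apply/eqP.
rewrite /x1 /em /q !dotE (dotC xn xm) (dotC gm xm) (dotC gn xm) (dotC sg xm).
rewrite (dotC gm xn) (dotC gn xn) (dotC sg xn) (dotC gn gm) (dotC sg gm).
rewrite (dotC sg gn).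
by field: rs.
Qed.

Lemma silver_run_take m n x g s f e :
  (m <= n)%N -> silver_run n x g s f e -> silver_run m x g s f e.
Proof.
move=> mn [h1 h2 h3]; split=> [j jm|i j im jm|i j im jm].
- exact: h1 (leq_trans jm mn).
- by apply: h2; apply: leq_trans mn.
- by apply: h3; lia.
Qed.

Lemma silver_run_drop k x g s f e :
  silver_run (2 ^ k.+1 - 1) x g s f e ->
  silver_run (2 ^ k - 1) (fun j => x (2 ^ k + j)%N) (fun j => g (2 ^ k + j)%N)
    (fun j => s (2 ^ k + j)%N) (fun j => f (2 ^ k + j)%N)
    (fun j => e (2 ^ k + j)%N).
Proof.
have e2 : (2 ^ k.+1 = 2 * 2 ^ k)%N by rewrite expnS.
move=> [h1 h2 h3]; split=> [j jm|i j im jm|i j im jm].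
- by rewrite /p -(silver_shift k) // addnS; apply: h1; lia.
- by apply: h2; lia.
- by apply: h3; lia.
Qed.

Lemma sum_weighted_sqr n (w : nat -> R) (s : nat -> V) (v : V) :
  \sum_(j < n) w j * dot (v + s j) (v + s j) =
  (\sum_(j < n) w j) * dot v v + 2 * dot v (\sum_(j < n) w j *: s j)
  + \sum_(j < n) w j * dot (s j) (s j).
Proof.
rewrite dot_sumr big_distrl big_distrr -!big_split /=.
by apply: eq_bigr => j _; rewrite !dotE (dotC (s j) v); ring.
Qed.

(** The weights are existential since later only their signs and total matter. The linearization of
    [h] at [x 1], evaluated at [x 0], stands in for [e 0], as [x 0] may lie outside the domain of
    [h]. *)
Lemma run_block k x g s f e (q := r ^+ k.+1) (n := (2 ^ k.+1 - 1)%N) :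
  silver_run n x g s f e ->
  exists th : nat -> R,
    [/\ forall j, 0 <= th j,
        \sum_(j < n) th j = q * (q - 1) &
        \sum_(j < n) th j *
          (dot (g n + s j.+1) (g n + s j.+1)
           + 2 * (e n - e j.+1 - dot (s j.+1) (x n - x j.+1)))
        + \sum_(j < n) p j * dot (s j.+1) (s j.+1)
        <= 2 * \sum_(j < n) run_term g s f e j - 2 * (q - 1) * (f n + e n)
           + 2 * (e 1%N + dot (x 0%N - x 1%N) (s 1%N)) - 2 * e n].
Proof.
rewrite {}/q {}/n; elim: k x g s f e => [|k IH] x g s f e.
  rewrite !expr1 expn1 subn1 /= => -[h1 h2 _].
  have r1 : 1 < r := rho_gt1; have rs : r ^+ 2 = 2 * r + 1 := rho_sqr.
  exists (fun=> r * (r - 1)); split=> [_||].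
  - by rewrite mulr_ge0 // ?subr_ge0 ltW // rho_gt0.
  - by rewrite big_ord1.
  have Q01 := h2 0%N 1%N isT isT; have Q10 := h2 1%N 0%N isT isT.
  rewrite !big_ord1 /run_term /p /= silver1 -/r.
  rewrite -subr_ge0; rewrite /smooth_ineq -subr_ge0 in Q01.
  rewrite /smooth_ineq -subr_ge0 in Q10.
  have {}Q01 := mulr_ge0 (mulr_ge0 (ler0n R 2) (ltW rho_gt0)) Q01.
  have {}Q10 := mulr_ge0 (ler0n R 2) Q10.
  have := addr_ge0 Q01 Q10.
  move/le_trans; apply; rewrite le_eqVlt; apply/orP; left; apply/eqP.
  rewrite (h1 0%N isT) /p silver1 -/r -/(rho R) -/r.
  move: (x 0%N) (g 0%N) (g 1%N) (s 1%N) => x0 g0 g1 s1.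
  rewrite !dotE (dotC g0 x0) (dotC g1 x0) (dotC s1 x0) (dotC g1 g0).
  rewrite (dotC s1 g0) (dotC s1 g1).
  by field: rs.
move=> run.
(* The middle step, of size [silver M], leads from [x m] to [x M]; the second half runs from [x M]
   to [x n]. *)
set m := (2 ^ k.+1 - 1)%N; set n := (2 ^ k.+2 - 1)%N; set M := (2 ^ k.+1)%N.
have mM : m.+1 = M by exact: expn2_pred.
have nM : n = (M + m)%N.
  by rewrite /n /M /m expnS; have := expn_gt0 2 k.+1; lia.
have m0 : (0 < m)%N by rewrite /m expnS; have := expn_gt0 2 k; lia.
have [h1 h2 h3] := run.
have b1 : 1 <= silver M :> R := ltW (silver_gt1 M).
have qE : r ^+ k.+1 = r * (silver M - 1) := silver_exp2 k.+1.
have A1 : \sum_(j < m) p j = r ^+ k.+1 - 1 := sum_silver k.+1.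
have M0 : (0 < M)%N by rewrite -mM.
have mn : (m <= n)%N by rewrite nM leq_addl.
have Mn : (M <= n)%N by rewrite nM leq_addr.
have [th1 [th1_0 th1_s a1]] := IH _ _ _ _ _ (silver_run_take _ _ _ _ _ _ _ mn run).
have run2 := silver_run_drop _ _ _ _ _ _ run.
have [th2 [th2_0 th2_s a2]] := IH _ _ _ _ _ run2.
have {run2} [h1' h2' h3'] := run2.
rewrite -/m -/M addn0 -?nM in a1 a2 th1_s th2_s h1' h2' h3'.
set b : R := silver M in b1 qE.
set q := r ^+ k.+1 in a1 a2 th1_s th2_s A1 qE *.
have pm : p m = b by rewrite /p mM.
have b0 : 0 < b := lt_le_trans ltr01 b1.
(* The decrease of [h] over the middle step per unit of step size. *)
set del := (e m - e M) / b.
have bdel : b * del = e m - e M by rewrite /del mulrCA mulfV ?mulr1 // gt_eqF.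
have xM : x M = x m - b *: (g m + s M).
  by rewrite -pm -mM h1 // -/n nM -mM addSn ltnS leq_addl.
have hd : dot (s M) (g m + s M) <= del.
  have := h3 m M; rewrite -/n m0 mn Mn -mM /= mM => /(_ isT isT).
  rewrite {1}xM opprB addrCA subrr addr0 dotZr => H.
  by rewrite -(ler_pM2l b0) bdel; lra.
(* Each weighted term is bounded below independently of [j], using [|s j.+1 - s M|^2 >= 0], so only
   the total of [th1] remains. *)
have {}a1 : q * (q - 1) * (dot (g m) (g m) - dot (s M) (s M) + 2 * del)
    + \sum_(j < m) p j * dot (s j.+1) (s j.+1)
    <= 2 * \sum_(j < m) run_term g s f e j - 2 * (q - 1) * (f m + e m)
       + 2 * (e 1%N + dot (x 0%N - x 1%N) (s 1%N)) - 2 * e m.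
  apply: le_trans a1; rewrite lerD2r -th1_s big_distrl /=.
  apply: ler_sum => j _; apply: ler_wpM2l; first exact: th1_0.
  have j1 : (0 < j.+1 <= n)%N by apply: leq_trans mn.
  have := h3 m j.+1; rewrite -/n m0 mn => /(_ isT j1) H0.
  have := h3 M j.+1; rewrite -/n Mn -mM /= mM => /(_ isT j1).
  rewrite xM; have := dot_ge0 (s j.+1 - s M).
  move: H0; rewrite !dotE (dotC (s M) (s j.+1)) (dotC (s j.+1) (g m)).
  set sx := dot (s j.+1) (x m); set sxj := dot (s j.+1) (x j.+1).
  set gs := dot (g m) (s j.+1); set ss := dot (s j.+1) (s M).
  move=> H0 sqr H1.
  (* The subgradient inequality at [x M] gives this with the left side multiplied by [b], the one at
     [x m] with it multiplied by 0; [b >= 1] lies beyond the factor 1 in between. *)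
  have : del - gs - ss <= e m - e j.+1 - (sx - sxj).
    have [le0|gt0] := leP (del - gs - ss) 0; first by lra.
    have := mulr_ge0 (ltW gt0) (ltac:(lra) : 0 <= b - 1); nra.
  lra.
have pS (j : 'I_m) : p (M + j)%N = p j.
  by rewrite /p -addnS silver_shift // (ltn_ord j).
have eC : \sum_(j < m) run_term (fun j => g (M + j)%N) (fun j => s (M + j)%N)
      (fun j => f (M + j)%N) (fun j => e (M + j)%N) j
    = \sum_(j < m) run_term g s f e (M + j).
  by apply: eq_bigr => j _; rewrite /run_term pS // -!addnS.
have a2' : \sum_(j < m) th2 j *
          (dot (g n + s (M + j.+1)%N) (g n + s (M + j.+1)%N)
           + 2 * (e n - e (M + j.+1)%N
                  - dot (s (M + j.+1)%N) (x n - x (M + j.+1)%N)))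
    + \sum_(j < m) p j * dot (s (M + j.+1)%N) (s (M + j.+1)%N)
    <= 2 * \sum_(j < m) run_term g s f e (M + j)
       - 2 * (q - 1) * (f n + e n) + 2 * (e M - e n).
  (* [x M] results from a step, so the linearization at [x (M + 1)] is bounded there by [e M]. *)
  have H := h3 M (M + 1)%N; rewrite -/n Mn nM leq_add2l m0 addn1 andbT M0 dotC in H.
  have {}H := H isT isT.
  rewrite eC in a2; rewrite addn1 in a2; apply: le_trans a2 _; lra.
set C1 := \sum_(j < m) run_term g s f e j in a1 *.
set S1 := \sum_(j < m) p j * dot (s j.+1) (s j.+1) in a1 *.
set C2 := \sum_(j < m) run_term g s f e (M + j) in a2' eC *.
set S := \sum_(j < m) p j * dot (s (M + j.+1)%N) (s (M + j.+1)%N) in a2' *.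
set TH := \sum_(j < m) th2 j * _ in a2' *.
pose P := \sum_(j < m) p j *: s (M + j.+1)%N.
pose TP := \sum_(j < m) p j * (e n - e (M + j.+1)%N
                  - dot (s (M + j.+1)%N) (x n - x (M + j.+1)%N)).
(* With these shifts the subgradients are tested at [x m - g m - s M], the point at fraction [1 / b]
   from [x m] to [x M], where [e m - del] interpolates [e] linearly. Each gap is thus a convex
   combination of the gaps at [x m] and [x M], and is dropped as nonnegative. *)
have c1 : 2 * C2 <= (q - 1) * (2 * (f m + (e m - del)) - dot (g m) (g m))
    + dot (x M - x m) (x M - x m) - dot (x n - x m) (x n - x m)
    + 2 * dot (g m) (x M - x n) + 2 * dot (s M) P.
  have := run_reference m (fun j => x (M + j)%N) (fun j => g (M + j)%N)
   (fun j => s (M + j)%N) (fun j => f (M + j)%N) (fun j => e (M + j)%N)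
   (x m) (g m) (s M) (f m) (e m - del) h1'.
  rewrite /= eC -/P A1 addn0 -nM => H.
  apply: le_trans (H _) => [|j jm]; last by apply: h2; rewrite -/n //; lia.
  rewrite lerDl mulr_ge0 ?sumr_ge0 // => j _; rewrite mulr_ge0 //.
    exact: ltW (silver_gt0 _).
  have j1 : (0 < M + j.+1 <= n)%N by rewrite nM leq_add2l ltn_ord addnS.
  have := h3 m (M + j.+1)%N; rewrite -/n m0 mn => /(_ isT j1) Hm.
  have := h3 M (M + j.+1)%N; rewrite -/n Mn M0 => /(_ isT j1) HM.
  have b1' : 0 <= b - 1 by rewrite subr_ge0.
  rewrite -subr_ge0 in Hm; have {}Hm := mulr_ge0 b1' Hm.
  rewrite -(ler_pM2l b0) mulr0; move: Hm HM bdel; rewrite xM !dotE.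
  move: (dot _ (x m)) (dot _ (g m)) (dot _ (s M)) (dot _ (x (M + j.+1)%N)).
  clear; move=> *; nra.
(* The shifts [g n] and [- g n] cancel, so the subgradients are tested at [x n] itself; these gaps
   are kept as [TP]. *)
have c2 : 2 * C2 + 2 * TP <= (q - 1) * (2 * (f n + e n) - dot (g n) (g n))
    + dot (x M - x n) (x M - x n) + 2 * dot (g n) (x M - x n)
    - 2 * dot (g n) P.
  have := run_reference m (fun j => x (M + j)%N) (fun j => g (M + j)%N)
   (fun j => s (M + j)%N) (fun j => f (M + j)%N) (fun j => e (M + j)%N)
   (x n) (g n) (- g n) (f n) (e n) h1'.
  rewrite /= eC -/P A1 addn0 -nM opprK subrr dot0l subr0 dotNl => H.
  have -> : TP = \sum_(j < m) p j * (e n - e (M + j.+1)%N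
      - dot (s (M + j.+1)%N) (x n - g n + g n - x (M + j.+1)%N)).
    by apply: eq_bigr => j _; rewrite subrK.
  apply: le_trans (H _) _ => [j jm|]; first by apply: h2; rewrite -/n //; lia.
  lra.
have c3 := sum_weighted_sqr m p (fun j => s (M + j.+1)%N) (- s M).
have c4 := sum_weighted_sqr m p (fun j => s (M + j.+1)%N) (g n).
rewrite -/S -/P A1 in c3 c4.
have MjF j : (M + j < m)%N = false by apply/negbTE; rewrite -leqNgt; lia.
have MjE j : (M + j == m)%N = false by apply/negbTE; lia.
(* The weights of the first half were spent in [a1]. On the second half, [r ^+ 2] counts the uses of
   [a2'], and [r * p] matches the gaps [2 * r * TP]. *)
pose th j := if (j < m)%N then 0 else if j == m then r * b
  else r ^+ 2 * th2 (j - M)%N + r * p (j - M)%N.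
have thl (j : 'I_m) : th j = 0 by rewrite /th ltn_ord.
have thm : th m = r * b by rewrite /th ltnn eqxx.
have thr j : th (M + j)%N = r ^+ 2 * th2 j + r * p j.
  by rewrite /th MjF MjE addKn.
exists th; split.
- move=> j; rewrite /th; case: ifP => // _; case: ifP => _.
    by apply: mulr_ge0; apply: ltW => //; exact: rho_gt0.
  apply: addr_ge0; apply: mulr_ge0 => //.
  + exact/exprn_ge0/ltW/rho_gt0.
  + exact/ltW/rho_gt0.
  + exact/ltW/silver_gt0.
- rewrite (sum_silver_split _ k.+1 th) -/m -/M thm.
  rewrite big1 => [|j _]; last exact: thl.
  under eq_bigr do rewrite thr.
  rewrite add0r big_split -!big_distrr /= th2_s A1 [r ^+ k.+2]exprS -/q.
  have rs : r ^+ 2 = 2 * r + 1 := rho_sqr.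
  by rewrite qE; ring: rs.
- rewrite (sum_silver_split _ k.+1 (fun j => th j * (dot (g n + s j.+1) (g n + s j.+1)
           + 2 * (e n - e j.+1 - dot (s j.+1) (x n - x j.+1))))).
  rewrite (sum_silver_split _ k.+1 (fun j => p j * dot (s j.+1) (s j.+1))).
  rewrite (sum_silver_split _ k.+1 (run_term g s f e)).
  rewrite -/m -/M big1 => [|j _]; last by rewrite thl mul0r.
  rewrite add0r thm mM pm -/S1 -/C1 -/C2.
  have -> : \sum_(j < m) p (M + j)%N * dot (s (M + j).+1) (s (M + j).+1) = S.
    by apply: eq_bigr => j _; rewrite pS addnS.
  under eq_bigr do rewrite thr -addnS.
  have emE : e m = e M + b * del by rewrite bdel addrC subrK.
  have sq : 0 <= S - 2 * dot (s M) P + (q - 1) * dot (s M) (s M).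
    move: c3; rewrite !dotNl !dotNr opprK => c3.
    have : 0 <= \sum_(j < m) p j * dot (- s M + s (M + j.+1)%N) (- s M + s (M + j.+1)%N).
      by apply: sumr_ge0 => j _; rewrite mulr_ge0 ?dot_ge0 // ltW // silver_gt0.
    by rewrite c3; lra.
  have -> : \sum_(i < m) (r ^+ 2 * th2 i + r * p i) *
       (dot (g n + s (M + i.+1)%N) (g n + s (M + i.+1)%N) +
        2 * (e n - e (M + i.+1)%N
             - dot (s (M + i.+1)%N) (x n - x (M + i.+1)%N)))
    = r ^+ 2 * TH + r * ((q - 1) * dot (g n) (g n) + 2 * dot (g n) P + S)
      + 2 * r * TP.
    rewrite -c4 /TH /TP !big_distrr -!big_split /=.
    by apply: eq_bigr => j _; ring.
  have := doubling_combination b del (f m) (f n) (e M) (e n) S1 S TH TP C1 C2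
    (2 * (e 1%N + dot (x 0%N - x 1%N) (s 1%N))) (x m) (g m) (s M) (g n) (x n) P b1.
  rewrite -emE -xM -qE -/q => /(_ a1 a2' c1 c2 sq) K.
  have Qmn : smooth_ineq (x m) (x n) (g m) (g n) (f m) (f n) by apply: h2; rewrite -/n.
  have Qnm : smooth_ineq (x n) (x m) (g n) (g m) (f n) (f m) by apply: h2; rewrite -/n.
  have {K} := K Qmn Qnm hd.
  rewrite /run_term pm mM [r ^+ k.+2]exprS -/q !addrA => K.
  exact: K.
Qed.

End AbstractRun.

(** * The rate for a normalized run *)

Section Rate.
Context {R : realType} {d : nat}.
Let r := rho R.
Let V := 'rV[R]_d.

(* The minimizer is normalized to the origin, with zero value, gradient and
   subgradient. *)
Lemma silver_run_rate k (x g s : nat -> V) (f e : nat -> R)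
    (n := (2 ^ k.+1 - 1)%N) :
  silver_run n x g s f e ->
  (forall j, (j <= n)%N -> smooth_ineq 0 (x j) 0 (g j) 0 (f j)) ->
  (forall j, (0 < j <= n)%N -> e j <= dot (s j) (x j)) ->
  (4 * r ^+ k.+1 - 2) * (f n + e n)
    <= (1 + (Num.sqrt 2)^-1) * dot (x 0%N) (x 0%N).
Proof.
move=> run hQ hs.
have [h1 h2 h3] := run.
have [th [th0 th_s a1]] := run_block _ _ _ _ _ _ run.
rewrite -/n -/r in a1 th_s.
have n0 : (0 < n)%N by rewrite /n expnS; have := expn_gt0 2 k; lia.
have A := sum_silver (R := R) k.+1; rewrite -/n -/r in A.
have c1 := run_reference n x g s f e 0 0 0 0 0 h1
  (fun j jn => hQ j (ltnW jn)).
have r1 : 1 < r := rho_gt1.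
set q := r ^+ k.+1 in a1 th_s A c1 *.
have q1 : 1 < q by rewrite /q exprn_egt1.
have q0 : 0 < q by lra.
have {}c1 : 2 * \sum_(j < n) run_term g s f e j
    <= dot (x 0%N) (x 0%N) - dot (x n) (x n).
  have : 0 <= \sum_(j < n) silver j.+1
      * (0 - e j.+1 - dot (s j.+1) (0 - 0 - 0 - x j.+1)).
    apply: sumr_ge0 => j _; rewrite mulr_ge0 ?(ltW (silver_gt0 _)) //.
    have := hs j.+1; rewrite /= (ltn_ord j) => /(_ isT).
    by rewrite !sub0r !dotE; lra.
  by move: c1; rewrite !subr0 !dot0l; lra.
have [y xnE] : exists y, x n = q *: y.
  by exists (q^-1 *: x n); rewrite scalerA mulfV ?scale1r // gt_eqF.
(* As in the bound on [a1] in [run_block], now with the points [x n] and 0, the factor [q >= 1], and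
   the square [|g n + s j.+1 - y|^2]. *)
have LB : (q - 1) * (2 * e n + 2 * q * dot (g n) y - q * dot y y)
    <= \sum_(j < n) th j * (dot (g n + s j.+1) (g n + s j.+1)
           + 2 * (e n - e j.+1 - dot (s j.+1) (x n - x j.+1))).
  have -> : (q - 1) * (2 * e n + 2 * q * dot (g n) y - q * dot y y)
      = \sum_(j < n) th j * (2 * (e n / q) + 2 * dot (g n) y - dot y y).
    by rewrite -big_distrl /= th_s; field; rewrite gt_eqF.
  apply: ler_sum => j _; apply: ler_wpM2l; first exact: th0.
  have j1 : (0 < j.+1 <= n)%N by rewrite /= ltn_ord.
  have := h3 n j.+1; rewrite -/n n0 leqnn => /(_ isT j1).
  have := hs _ j1; have := dot_ge0 (g n + s j.+1 - y).
  have enE : e n = q * (e n / q) by field; rewrite gt_eqF.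
  move: (e n / q) enE => t ->; rewrite xnE.
  rewrite !dotE (dotC y (g n)) (dotC y (s j.+1)) (dotC (s j.+1) (g n)).
  move: (dot (s j.+1) y) (dot (s j.+1) (x j.+1)) => sy sx sqr H0 H1.
  have : t - sy <= q * t - e j.+1 - (q * sy - sx).
    have [le0|gt0] := leP (t - sy) 0; first by lra.
    have q1' : 0 <= q - 1 by lra.
    have := mulr_ge0 (ltW gt0) q1'; nra.
  lra.
(* Since [silver 1 = sqrt 2], the first square absorbs the product of [x 0] and [s 1] by Young's
   inequality, which costs [(sqrt 2)^-1 * |x 0|^2]. *)
have S1 : Num.sqrt 2 * dot (s 1%N) (s 1%N)
    <= \sum_(j < n) silver j.+1 * dot (s j.+1) (s j.+1).
  rewrite (bigD1 (Ordinal n0)) //= silver1 /rho addrAC subrr add0r lerDl.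
  apply: sumr_ge0 => j _.
  by rewrite mulr_ge0 ?dot_ge0 // ltW // silver_gt0.
have e1 := hs 1%N; rewrite n0 in e1; have {}e1 := e1 isT.
have w0 : 0 < Num.sqrt 2 :> R by rewrite sqrtr_gt0.
have s0 : 2 * dot (x 0%N) (s 1%N) - Num.sqrt 2 * dot (s 1%N) (s 1%N)
    <= (Num.sqrt 2)^-1 * dot (x 0%N) (x 0%N).
  rewrite -subr_ge0.
  have := mulr_ge0 (ltW w0) (dot_ge0 ((Num.sqrt 2)^-1 *: x 0%N - s 1%N)).
  move/le_trans; apply; rewrite le_eqVlt; apply/orP; left; apply/eqP.
  by rewrite !dotE (dotC (s 1%N) (x 0%N)); field; rewrite gt_eqF.
(* Adding this inequality with weight [2 * q] raises the coefficient of [f n] from [2 * (q - 1)] to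
   [4 * q - 2]; the quadratic terms left over form [q * |y - g n|^2]. *)
have Qn := hQ n (leqnn n).
have sqr := mulr_ge0 (ltW q0) (dot_ge0 (y - g n)).
rewrite /smooth_ineq !sub0r xnE in Qn; rewrite xnE in c1.
have {}Qn := ler_wpM2l (ltW q0) Qn.
move: a1 LB c1 e1 Qn sqr.
rewrite !dotE (dotC (x 1%N)) (dotC y (g n)).
move: (\sum_(j < n) _) (\sum_(j < n) _) (\sum_(j < n) _) S1 => S L C.
nra.
Qed.
End Rate.

(** * Interpolation inequality of smooth convex functions *)

Section SmoothConvex.
Context {R : realType} {d : nat}.
Variable f : 'rV[R]_d -> R.
Hypothesis f_smooth : smooth 1 f.
Implicit Types x y v : 'rV[R]_d.
Let V := 'rV[R]_d.
Let g := gradient f.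

Lemma derive_gradient x v : 'D_v f x = dot (g x) v.
Proof.
have [df _] := f_smooth.
rewrite deriveE // {1}(row_sum_delta v) linear_sum; apply: eq_bigr => i _.
by rewrite linearZ mxE deriveE // mulrC.
Qed.

Lemma is_derive_line x v (t : R) :
  is_derive t 1 (fun t => f (x + t *: v)) (dot (g (x + t *: v)) v).
Proof.
have [df _] := f_smooth.
have E : (fun h : R => h^-1 *: (((fun t => f (x + t *: v)) \o shift t) (h *: 1)
    - f (x + t *: v)))
  = (fun h : R => h^-1 *: ((f \o shift (x + t *: v)) (h *: v)
    - f (x + t *: v))).
  apply/funext => h /=; congr (_ *: (f _ - _)).
  by rewrite [h *: 1]mulr1 scalerDl addrCA.
apply: DeriveDef.
- by rewrite /derivable E; apply: diff_derivable.
- by rewrite -derive_gradient /derive E.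
Qed.

Lemma gradient_lipschitz x y :
  dot (g x - g y) (g x - g y) <= dot (x - y) (x - y).
Proof.
have [_ /(_ x y)] := f_smooth; rewrite mul1r => H.
by rewrite -!enorm_sqr lerXn2r // nnegrE enorm_ge0.
Qed.

(** The mean value theorem replaces integration along the segment: the difference [phi] to the
    quadratic model has nonpositive derivative on (0, 1). *)
Lemma descent x v : f (x + v) <= f x + dot (g x) v + 2^-1 * dot v v.
Proof.
pose phi (t : R) := f (x + t *: v) - (dot (g x) v * t + 2^-1 * dot v v * t ^+ 2).
pose dphi (t : R) := dot (g (x + t *: v)) v - (dot (g x) v + dot v v * t).
have phiD (t : R) : is_derive t 1 phi (dphi t).
  have D1 := is_derive_line x v t.
  apply: is_deriveB.
  apply: is_derive_eq.
  change (dot (g x) v * 1 + 2^-1 * dot v v * (t * 1 + t * 1)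
    = dot (g x) v + dot v v * t).
  by field.
have [|c c01 E] := MVT ltr01 (fun t _ => phiD t).
  by apply: derivable_within_continuous => t _; apply: ex_derive.
have c0 : 0 < c by move: c01; rewrite in_itv => /andP[].
have : dphi c <= 0.
  have L := gradient_lipschitz (x + c *: v) x.
  rewrite -(ler_pM2l c0) mulr0 /dphi.
  have := dot_ge0 (g (x + c *: v) - g x - c *: v).
  move: L; rewrite [x + _]addrC addrK.
  move: (g (c *: v + x)) (g x) => a b.
  rewrite !dotE (dotC b a) (dotC v a) (dotC v b).
  move: (dot a a) (dot b b) (dot a b) (dot a v) (dot b v) (dot v v).
  by clear=> *; nra.
move: E; rewrite subr0 mulr1 => <-.
rewrite /phi scale0r scale1r !addr0 expr0n expr1n /=.
lra.
Qed.

Hypothesis f_convex : convex_function [set: convex_lmodType 'rV[R]_d] f.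

Lemma gradient_ineq x y : f x + dot (g x) (y - x) <= f y.
Proof.
have [df _] := f_smooth.
rewrite -lerBrDl -derive_gradient.
have dx : derivable f x (y - x) by exact: diff_derivable.
have /cvg_dnbhs_at_right cx := dx.
apply: (cvgr_to_le cx).
near=> h.
have h0 : 0 < h by near: h; exact: nbhs_right_gt.
have h1 : h <= 1 by near: h; exact: nbhs_right_le.
have H : f (h *: y + (1 - h) *: x) <= h * f y + (1 - h) * f x :=
  f_convex (Itv01 (ltW h0) h1) y x (in_setT _) (in_setT _).
change (h^-1 * (f (h *: (y - x) + x) - f x) <= f y - f x).
rewrite ler_pdivrMl //.
have -> : h *: (y - x) + x = h *: y + (1 - h) *: x.
  by rewrite scalerBr scalerBl scale1r -addrA; congr (_ + _); rewrite addrC.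
lra.
Unshelve. all: by end_near.
Qed.

(* Minimize the upper bound of [descent] at [y] and compare with the lower bound
   of [gradient_ineq] at [x]. *)
Lemma smooth_ineq_gradient x y : smooth_ineq y x (g y) (g x) (f y) (f x).
Proof.
have H1 := descent y (g x - g y); have H2 := gradient_ineq x (y + (g x - g y)).
move: (le_trans H2 H1); rewrite /smooth_ineq !dotE.
rewrite (dotC (g x) (g y)); lra.
Qed.


End SmoothConvex.

(** * Optimality and existence for proximal steps *)

Section Prox.
Context {R : realType} {d : nat}.
Variable h : 'rV[R]_d -> \bar R.
Hypothesis h_proper : proper_fun h.
Hypothesis h_convex : econvex_fun h.
Let V := 'rV[R]_d.

Lemma argmin_fin_num (a : R) (phi : V -> R) (z : V) :
  0 < a -> argmin (fun y => a%:E * h y + (phi y)%:E)%E z -> h z \is a fin_num.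
Proof.
move=> a0 zmin; have [hNy [y hy]] := h_proper.
rewrite fin_numE hNy /=; apply: contraNneq hy => hz.
have := zmin y; rewrite hz gt0_muley ?lte_fin // addye // leye_eq.
case: (h y) (hNy y) => // t _.
Qed.

(** Compare [z] with [z + u (y - z)], divide by [u] and let [u] tend to 0. A quadratic upper model
    of [phi] covers both the prox objective and, through [descent], the minimizer of [F]. *)
Lemma argmin_subgradient (a : R) (phi : V -> R) (g z : V) (C : R) :
  0 < a ->
  (forall v, phi (z + v) <= phi z + dot g v + C * dot v v) ->
  argmin (fun y => a%:E * h y + (phi y)%:E)%E z ->
  forall y, ((fine (h z) + dot (- (a^-1 *: g)) (y - z))%:E <= h y)%E.
Proof.
move=> a0 phiz zmin y; have hz := argmin_fin_num _ _ _ a0 zmin.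
have [hNy _] := h_proper.
have hE := fineK hz; move: (fine (h z)) hE => e hE.
case hy : (h y) (hNy y) => [t| |] // _; last by rewrite leey.
rewrite lee_fin dotNl dotZl -(ler_pM2l a0) mulrDr mulrN mulrA mulfV ?gt_eqF //.
rewrite mul1r lerBlDr; have [v vE] : exists v, v = y - z by exists (y - z).
rewrite -vE.
suff K (u : R) : 0 < u <= 1 -> a * e <= a * t + dot g v + u * (C * dot v v).
  apply/ler_addgt0Pr => ep ep0.
  pose u := Num.min 1 (ep / (1 + `|C * dot v v|)).
  have D0 : 0 < 1 + `|C * dot v v| by rewrite ltr_pwDl.
  have u0 : 0 < u by rewrite lt_min ltr01 divr_gt0.
  apply: le_trans (K u _) _; first by rewrite u0 ge_min lexx.
  rewrite lerD2l.
  apply: (@le_trans _ _ (u * (1 + `|C * dot v v|))).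
    by rewrite ler_pM2l // (le_trans (ler_norm _)) // lerDr.
  by rewrite -ler_pdivlMr // ge_min lexx orbT.
move=> /andP[u0 u1].
have u01 : 0 <= u <= 1 by rewrite ltW.
have := h_convex z y u u01; rewrite hy -hE -!EFinM -EFinD.
have := zmin ((1 - u) *: z + u *: y); rewrite -hE -EFinM -EFinD.
have -> : (1 - u) *: z + u *: y = z + u *: v.
  by rewrite vE scalerBl scale1r scalerBr -addrA; congr (_ + _); rewrite addrC.
case: (h (z + u *: v)) (hNy (z + u *: v)) => [w| |] // _.
rewrite -EFinM -EFinD !lee_fin => H1 H2.
have H3 := phiz (u *: v); rewrite !dotE in H3.
have H4 := ler_wpM2l (ltW a0) H2.
rewrite -(ler_pM2l u0).
move: (dot g v) (dot v v) H3 => gv vv H3.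
nra.
Qed.

Hypothesis h_closed : closed_fun h.

(** The objective is merely lower semicontinuous, so the continuous [J] is minimized over the
    epigraph of [h] instead; the affine minorant makes its sublevel set there compact. *)
Lemma argmin_prox (a : R) (x g : V) (c : R) :
  0 < a -> (forall z, ((c + dot g z)%:E <= h z)%E) ->
  argmin (fun z => a%:E * h z + (2^-1 * enorm (z - x) ^+ 2)%:E)%E (prox a h x).
Proof.
move=> a0 minorant; apply: xgetPex.
have [hNy [y0 hy0]] := h_proper.
have [t0 y0E] : exists t0, h y0 = t0%:E.
  by case: (h y0) hy0 (hNy y0) => // t _ _; exists t.
pose J (p : V * R) : R := a * p.2 + 2^-1 * dot (p.1 - x) (p.1 - x).
have J_cont : continuous J.
  have dot_cont : continuous (fun v : V => dot v v).
    apply: continuous_big => [|i _ v]; first exact: add_continuous.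
    have vi : {for v, continuous (fun u : V => u 0 i)} by exact: coord_continuous.
    exact: (continuousM vi vi).
  have xc : continuous (fun p : V * R => p.1 - x).
    by move=> p; apply: cvgB; [exact: cvg_fst|exact: cvg_cst].
  move=> p; apply: cvgD; apply: cvgM; [exact: cvg_cst|exact: cvg_snd|exact: cvg_cst|].
  exact: (continuous_comp (xc p) (dot_cont _)).
pose K := epigraph h `&` (J @^-1` [set u | u <= J (y0, t0)]).
have K_closed : closed K.
  apply: closedI; first exact: h_closed.
  by have /continuous_closedP := J_cont; apply; exact: closed_le.
have K_compact : compact K.
  (* Obtained by completing the square [|u / 2 + a g|^2] for the minorant at [x + u]. *)
  pose B := 4 * (J (y0, t0) - a * c - a * dot g x + a ^+ 2 * dot g g).
  have bound (p : V * R) : K p -> dot (p.1 - x) (p.1 - x) <= B.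
    move=> [/= pe pJ]; have := le_trans (minorant p.1) pe; rewrite lee_fin => pm.
    have {}pm := ler_wpM2l (ltW a0) pm.
    have [u uE] : exists u, p.1 = x + u by exists (p.1 - x); rewrite addrC subrK.
    move: pJ pm; rewrite {1}/J uE [x + u]addrC addrK !dotE => pJ pm.
    have := dot_ge0 (2^-1 *: u + a *: g); rewrite !dotE (dotC u g) /B.
    lra.
  pose b := B + 1.
  pose lo := c + dot g x - 2^-1 * (dot g g + B).
  pose hi := J (y0, t0) / a.
  have box_compact : compact
      ([set v : V | forall i, v ord0 i \in `[x ord0 i - b, x ord0 i + b]]
       `*` `[lo, hi]).
    apply: compact_setX; last exact: segment_compact.
    apply: (@rV_compact _ _ (fun i => `[x ord0 i - b, x ord0 i + b]%classic)).
    by move=> i; apply: segment_compact.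
  apply: subclosed_compact K_closed box_compact _ => -[v t] Kvt.
  have vB := bound _ Kvt; move: Kvt vB => [/= pe pJ] vB; split=> /=.
    move=> i; have : ((v - x) 0 i) ^+ 2 <= B.
      apply: le_trans vB; rewrite /dot (bigD1 i) //= -expr2 lerDl.
      by apply: sumr_ge0 => j _; rewrite -expr2 sqr_ge0.
    rewrite !mxE in_itv /= /b; move: (v 0 i) (x 0 i) => vi xi sq.
    have := sqr_ge0 (vi - xi + 1); have := sqr_ge0 (vi - xi - 1).
    by have := sqr_ge0 (vi - xi); move=> *; apply/andP; split; lra.
  rewrite in_itv /=; apply/andP; split.
    have := le_trans (minorant v) pe; rewrite lee_fin; apply: le_trans.
    have := dot_ge0 (g + (v - x)).
    have [u uE] : exists u, v = x + u by exists (v - x); rewrite addrC subrK.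
    move: vB; rewrite uE [x + u]addrC addrK !dotE (dotC u g) /lo.
    lra.
  rewrite /hi ler_pdivlMr // mulrC; move: pJ; rewrite {1}/J /=.
  by have := dot_ge0 (v - x); lra.
have K0 : K !=set0.
  by exists (y0, t0); split => //=; rewrite /epigraph /= y0E.
have [[z t] + zmin] := compact_EVT_min K0 K_compact (continuous_subspaceT J_cont).
rewrite inE => -[ze zJ].
exists z => y; rewrite !enorm_sqr.
have {}ze : (h z <= t%:E)%E by [].
case hz : (h z) (hNy z) ze => [e| |] // _; rewrite lee_fin => et.
case hy : (h y) (hNy y) => [w| |] // _; last first.
  by rewrite gt0_muley ?lte_fin // addye // leey.
rewrite -!EFinM -!EFinD lee_fin.
have ze : J (z, e) <= J (z, t) by rewrite /J /= lerD2r ler_pM2l.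
apply: (le_trans ze); rewrite -/(J (y, w)).
have [yJ|/ltW yJ] := leP (J (y, w)) (J (y0, t0)); last exact: le_trans zJ yJ.
by apply: zmin; rewrite inE; split => //=; rewrite /epigraph /= hy.
Qed.

End Prox.

(** * Moving a linear term from [f] to [h] *)

Section Tilting.
Context {R : realType} {d : nat}.
Implicit Types u v w c : 'rV[R]_d.

Lemma smooth_ineq_tilt u v gu gv w c (fu fv a : R) :
  smooth_ineq u v gu gv fu fv ->
  smooth_ineq (u - w) (v - w) (gu - c) (gv - c)
    (fu - a - dot c (u - w)) (fv - a - dot c (v - w)).
Proof.
rewrite /smooth_ineq !opprB ![_ - _ + (_ - _)]addrA !subrK !dotE; lra.
Qed.

Lemma subgradient_tilt u v s w c (eu ev b : R) :
  ev + dot s (u - v) <= eu ->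
  ev - b + dot c (v - w) + dot (s + c) (u - w - (v - w))
    <= eu - b + dot c (u - w).
Proof. rewrite opprB addrA subrK !dotE; lra. Qed.

End Tilting.

(** * Reduction of the method to a normalized run *)

Lemma prox_grad_silver_rate (R : realType) (d : nat) (f : 'rV[R]_d -> R)
    (h : 'rV[R]_d -> \bar R) (xstar x0 : 'rV[R]_d) (k : nat) :
  let F := fun x : 'rV[R]_d => ((f x)%:E + h x)%E in
  let n := (2 ^ k - 1)%N in
  convex_function [set: convex_lmodType 'rV[R]_d] f ->
  smooth 1 f ->
  proper_fun h -> closed_fun h -> econvex_fun h ->
  argmin F xstar ->
  (1 <= k)%N ->
  (F (prox_grad f h silver x0 n) - F xstar <=
    (rho R / (Num.sqrt 2 * (4 * rho R ^+ k - 2))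
      * enorm (x0 - xstar) ^+ 2)%:E)%E.
Proof.
case: k => // k F n f_convex f_smooth h_proper h_closed h_convex Fmin _.
have Fmin1 : argmin (fun y => 1%:E * h y + (f y)%:E)%E xstar.
  by move=> y; rewrite !mul1e ![(h _ + _)%E]addeC; exact: Fmin.
have hs_fin := argmin_fin_num _ h_proper _ _ _ ltr01 Fmin1.
set gs := gradient f xstar.
have sub_s := argmin_subgradient _ h_proper h_convex _ _ gs _ _ ltr01
  (descent _ f_smooth xstar) Fmin1.
set es := fine (h xstar) in sub_s.
pose X := prox_grad f h silver x0.
pose w t := X t - silver t.+1 *: gradient f (X t).
have Xmin t : argmin (fun z => (silver t.+1)%:E * h z
    + (2^-1 * enorm (z - w t) ^+ 2)%:E)%E (X t.+1).
  (* The affine minorant comes from the subgradient [- gs] of [h] at the minimizer. *)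
  apply: (argmin_prox _ h_proper h_closed _ _ (- gs) (es + dot gs xstar)).
    exact: silver_gt0.
  move=> z; apply: le_trans (sub_s z); rewrite lee_fin invr1 scale1r.
  by rewrite !dotE; lra.
have hX_fin t : h (X t.+1) \is a fin_num.
  exact: (argmin_fin_num _ h_proper _ _ _ (silver_gt0 _) (Xmin t)).
(* The subgradient produced by the prox step; the value at 0 is a placeholder. *)
pose S t := if t is u.+1 then - ((silver t)^-1 *: (X t - w u)) else 0.
have XS t : X t.+1 = X t - silver t.+1 *: (gradient f (X t) + S t.+1).
  rewrite /S scalerDr scalerN scalerA mulfV ?scale1r; last first.
    by rewrite gt_eqF // silver_gt0.
  by rewrite opprD opprK addrA addrC subrK.
have sub t y : ((fine (h (X t.+1)) + dot (S t.+1) (y - X t.+1))%:E <= h y)%E.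
  apply: (argmin_subgradient _ h_proper h_convex _ _ _ _ 2^-1 (silver_gt0 _) _
    (Xmin t)) => v.
  rewrite !enorm_sqr addrAC; move: (X t.+1 - w t) => u.
  by rewrite !dotE (dotC v u); lra.
pose x j := X j - xstar.
pose g j := gradient f (X j) - gs.
pose s j := S j + gs.
pose fj j := f (X j) - f xstar - dot gs (X j - xstar).
pose e j := fine (h (X j)) - es + dot gs (X j - xstar).
have run : silver_run n x g s fj e.
  split=> [j _|i j _ _|[//|i] [//|j] _ _].
  - rewrite /x /g /s XS [_ - gs + _]addrACA [- gs + gs]addrC subrr addr0.
    by rewrite addrAC.
  - exact/smooth_ineq_tilt/smooth_ineq_gradient.
  - by apply: subgradient_tilt; rewrite -lee_fin (fineK (hX_fin i)).
have rate := silver_run_rate k x g s fj e run.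
have {rate} : (4 * rho R ^+ k.+1 - 2) * (fj n + e n)
    <= (1 + (Num.sqrt 2)^-1) * dot (x 0%N) (x 0%N).
  apply: rate => [j _|[//|j] _].
  - have := smooth_ineq_tilt _ _ _ _ xstar gs _ _ (f xstar)
      (smooth_ineq_gradient _ f_smooth f_convex (X j) xstar).
    by rewrite !subrr dot0r subr0.
  - have sj : fine (h (X j.+1)) + dot (S j.+1) (xstar - X j.+1) <= es.
      by rewrite -lee_fin (fineK hs_fin).
    have := subgradient_tilt _ _ _ xstar gs _ _ es sj.
    by rewrite !subrr dot0r addr0 sub0r dotNr subr_le0.
have -> : fj n + e n = f (X n) + fine (h (X n)) - (f xstar + es).
  by rewrite /fj /e; ring.
rewrite -enorm_sqr -/(x 0%N) => rate.
have hn : h (X n) \is a fin_num.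
  have n0 : (0 < n)%N by rewrite /n expnS; have := expn_gt0 2 k; lia.
  by rewrite -(prednK n0); exact: hX_fin.
rewrite /F -/X -(fineK hn) -(fineK hs_fin) -/es -!EFinD lee_fin.
have w0 : 0 < Num.sqrt 2 :> R by rewrite sqrtr_gt0.
have q1 : 1 < rho R ^+ k.+1 by rewrite exprn_egt1 // rho_gt1.
have D0 : 0 < 4 * rho R ^+ k.+1 - 2 by lra.
rewrite -(ler_pM2l D0); apply: le_trans rate _.
rewrite le_eqVlt; apply/orP; left; apply/eqP.
move: (rho R ^+ k.+1) q1 D0 => q q1 D0; rewrite /rho.
by field; rewrite !gt_eqF.
Qed.

(** * Asymptotics of the constant *)

Lemma silver_rate_asymp (R : realType) :
  asymp_equiv
    (fun k => rho R / (Num.sqrt 2 * (4 * rho R ^+ k - 2)))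
    (fun k => rho R / (4 * Num.sqrt 2 *
                ((2 ^ k - 1)%N%:R `^ (ln (rho R) / ln 2)))).
Proof.
rewrite /asymp_equiv; set L := ln (rho R) / ln 2.
have r0 := rho_gt0 (R := R); have r1 := rho_gt1 (R := R).
have ln2 : 0 < ln 2 :> R by rewrite ln_gt0 // ltr1n.
have powL k : (2 ^+ k : R) `^ L = rho R ^+ k.
  rewrite /powR gt_eqF ?exprn_gt0 // lnXn // /L mulrnAr divfK ?gt_eqF //.
  by rewrite -lnXn // lnK // posrE exprn_gt0.
(* The quotient after cancelling [rho ^ k], which equals [(2 ^ k)] to the power [L]. *)
pose u k : R := expR (L * ln (1 - 2^-1 ^+ k)) / (1 - 2^-1 * (rho R)^-1 ^+ k).
have cvgu : u k @[k --> \oo] --> (1 : R).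
  rewrite -[X in _ --> X]divr1; apply: cvgM.
    rewrite -[X in _ --> X](expR0) -(mulr0 L) -ln1.
    apply: continuous_cvg; first exact: continuous_expR.
    apply: cvgM; first exact: cvg_cst.
    apply: continuous_cvg; first exact: continuous_ln.
    rewrite -[X in _ --> X]subr0; apply: cvgB; first exact: cvg_cst.
    by apply: cvg_expr; rewrite ger0_norm // invf_lt1 // ltr1n.
  apply: cvgV; first exact: oner_neq0.
  rewrite -[X in _ --> X]subr0 -[X in _ - X](mulr0 2^-1).
  apply: cvgB; first exact: cvg_cst.
  apply: cvgM; first exact: cvg_cst.
  by apply: cvg_expr; rewrite ger0_norm ?invr_ge0 ?(ltW r0) // invf_lt1.
apply: cvg_trans cvgu; apply: near_eq_cvg.
(* For [k >= 1] the base [1 - 2^-1 ^+ k] is positive, so its power is given by [expR] and [ln]. *)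
exists 1%N => // k /= k0.
have h0 : 0 < 2^-1 ^+ k :> R by rewrite exprn_gt0.
have h1 : 2^-1 ^+ k < 1 :> R by rewrite exprn_ilt1 -?lt0n // invf_lt1 ?ltr1n.
have q1 : 1 < rho R ^+ k by rewrite exprn_egt1 // -lt0n.
rewrite natrB ?expn_gt0 // natrX.
have -> : (2%:R ^+ k - 1 : R) = 2 ^+ k * (1 - 2^-1 ^+ k).
  by rewrite mulrBr mulr1 -exprMn mulfV // expr1n.
rewrite powRM ?exprn_ge0 // ?subr_ge0 ?ltW // powL.
have -> : (1 - 2^-1 ^+ k : R) `^ L = expR (L * ln (1 - 2^-1 ^+ k)).
  by rewrite /powR gt_eqF ?subr_gt0.
rewrite /u [(rho R)^-1 ^+ k]exprVn; have := expR_gt0 (L * ln (1 - 2^-1 ^+ k)).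
move: (expR _) (rho R ^+ k) q1 => E q q1 E0.
have w0 : 0 < Num.sqrt 2 :> R by rewrite sqrtr_gt0.
field.
rewrite !gt_eqF //=; lra.
Qed.

Theorem theorem4p2 (R : realType) :
  (forall (d : nat) (f : 'rV[R]_d -> R) (h : 'rV[R]_d -> \bar R)
      (xstar x0 : 'rV[R]_d) (k : nat),
    let F := fun x : 'rV[R]_d => ((f x)%:E + h x)%E in
    let n := (2 ^ k - 1)%N in
    convex_function [set: convex_lmodType 'rV[R]_d] f ->
    smooth 1 f ->
    proper_fun h -> closed_fun h -> econvex_fun h ->
    argmin F xstar ->
    (1 <= k)%N ->
    (F (prox_grad f h silver x0 n) - F xstar <=
      (rho R / (Num.sqrt 2 * (4 * rho R ^+ k - 2))
        * enorm (x0 - xstar) ^+ 2)%:E)%E)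
  /\
  asymp_equiv
    (fun k => rho R / (Num.sqrt 2 * (4 * rho R ^+ k - 2)))
    (fun k => rho R / (4 * Num.sqrt 2 *
                ((2 ^ k - 1)%N%:R `^ (ln (rho R) / ln 2)))).
Proof.
split; last exact: silver_rate_asymp.
by move=> d f h xstar x0 k; exact: prox_grad_silver_rate.
Qed.
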